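(* Let $\mathcal{C}=\{A_1,\dots,A_L\}$ be a set of $L$ real symmetric $m\times m$ matrices. Then $\mathcal{C}$ is $\mathbf{D}_{m,Lm}$-SDO.
   Context: For $n\ge m$, $\mathrm{St}(m,n)=\{P\in\mathbb{R}^{n\times m}:P^{\mathsf T}P=I_m\}$. The set $\mathcal{C}$ is $\mathbf{D}_{m,n}$-SDO if there exist $P\in\mathrm{St}(m,n)$ and diagonal matrices $D^{(1)},\dots,D^{(L)}\in\mathbb{R}^{n\times n}$ such that $A_i=P^{\mathsf T}D^{(i)}P$ for all $1\le i\le L$. *)

(* Defs.v *)
From mathcomp Require Import all_boot all_order all_algebra.
From mathcomp Require Import reals.

Set Implicit Arguments.
Unset Strict Implicit.
Unset Printing Implicit Defensive.

Import GRing.Theory.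
Local Open Scope ring_scope.

(* St(m, n): the standing assumption m <= n need not be recorded, since
   P^T *m P = 1%:M already forces P to have rank m. *)
Definition stiefel (R : realType) (m n : nat) (P : 'M[R]_(n, m)) : Prop :=
  P^T *m P = 1%:M.

(* D_{m,n}-SDO. The collection {A_1, ..., A_L} is a family indexed by 'I_L, so
   repetitions are allowed; a single P must serve all its members. *)
Definition SDO (R : realType) (m n L : nat) (A : 'I_L -> 'M[R]_m) : Prop :=
  exists (P : 'M[R]_(n, m)) (D : 'I_L -> 'M[R]_n),
    [/\ stiefel P,
        forall i : 'I_L, is_diag_mx (D i)
      & forall i : 'I_L, A i = P^T *m D i *m P].
Arguments SDO {R m} n {L} A.

(* Main.v *)
Require Import Defs.
From mathcomp Require Import all_boot all_order all_algebra.
From mathcomp Require Import reals complex spectral.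
From mathcomp Require Import ring lra.

(** By the spectral theorem each [A i] is [Q_i^T *m L_i *m Q_i] with [Q_i]
    orthogonal and [L_i] diagonal. Stack the [L] matrices [Q_i] on top of each
    other and divide by the square root of [L]: the result [P] has [L * m] rows
    and [P^T *m P] is the average of the [Q_i^T *m Q_i], that is the identity.
    The block diagonal matrix with [L *: L_i] as its [i]-th block and zeros
    elsewhere selects the [i]-th summand, so that it compresses under [P] to
    [A i].

    The spectral theorem over a real closed field ([sym_spectral]) goes by
    induction on the dimension. A symmetric real matrix has
    an eigenvector over [R[i]]; its real and imaginary parts show that the
    eigenvalue is real, and one of them is a real eigenvector
    ([sym_eigenvector_ex]). A Householder reflection ([reflection_ex]) carries
    the first coordinate axis to that eigenvector; in the reflected coordinates
    the matrix is block diagonal with blocks of sizes 1 and [n], and the second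
    block is again symmetric. *)

Set Implicit Arguments.
Unset Strict Implicit.
Unset Printing Implicit Defensive.

Import Order.TTheory GRing.Theory Num.Theory.
Local Open Scope ring_scope.

Lemma mul_row_tr_ge0 (R : realFieldType) n (u : 'rV[R]_n) :
  0 <= (u *m u^T) 0 0.
Proof. by rewrite mxE sumr_ge0 // => i _; rewrite mxE -expr2 sqr_ge0. Qed.

Lemma mul_row_tr_eq0 (R : realFieldType) n (u : 'rV[R]_n) :
  ((u *m u^T) 0 0 == 0) = (u == 0).
Proof.
apply/eqP/eqP => [|->]; last by rewrite mul0mx mxE.
rewrite mxE => /psumr_eq0P u2_0; apply/rowP => i.
have /eqP : u 0 i * u^T i 0 = 0.
  by apply: u2_0 => // j _; rewrite mxE -expr2 sqr_ge0.
by rewrite !mxE -expr2 sqrf_eq0 => /eqP.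
Qed.

Lemma mul_row_trC (R : comPzRingType) n (u v : 'rV[R]_n) :
  u *m v^T = v *m u^T.
Proof. by rewrite [RHS]mx11_scalar -tr_scalar_mx -mx11_scalar trmx_mul trmxK. Qed.

(** The Householder reflection in the hyperplane orthogonal to [w = u - e]
    exchanges [e] and [u], because vectors of equal norm satisfy
    [w *m w^T = - 2 (e *m w^T)]. *)
Lemma reflection_ex (R : realFieldType) n (e u : 'rV[R]_n) :
  u *m u^T = e *m e^T ->
  exists H : 'M[R]_n, [/\ H^T = H, H *m H = 1%:M & e *m H = u].
Proof.
move=> uu_ee; pose w := u - e; pose c := (w *m w^T) 0 0.
have ww : w *m w^T = c%:M by rewrite [LHS]mx11_scalar.
have ew : e *m w^T = (- (c / 2))%:M.
  rewrite [LHS]mx11_scalar; congr _%:M.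
  have -> : c = ((e *m e^T) 0 0 - (e *m u^T) 0 0) * 2.
    rewrite /c /w (linearB trmx) /= mulmxBl !mulmxBr uu_ee (mul_row_trC u e).
    by rewrite !mxE; ring.
  rewrite /w (linearB trmx) /= mulmxBr !mxE.
  by set x := \sum_j _; set y := \sum_j _; field.
(* When [u = e] we have [c = 0], hence [2 / c = 0], and this is the identity. *)
exists (1%:M - (2 / c) *: (w^T *m w)); split.
- by rewrite linearB /= trmx1 linearZ /= trmx_mul trmxK.
- set K := w^T *m w; have KK : K *m K = c *: K.
    by rewrite /K mulmxA -(mulmxA _ w) ww mul_mx_scalar -scalemxAl.
  rewrite mulmxBl !mulmxBr !mul1mx mulmx1 -scalemxAl -scalemxAr KK !scalerA.
  have [c0|c0] := eqVneq c 0.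
    by rewrite c0 invr0 !(mulr0, mul0r, scale0r) !subr0.
  have -> : 2 / c * (2 / c) * c = 2 / c + 2 / c by field.
  by rewrite scalerDl opprB addrK subrK.
- rewrite mulmxBr mulmx1 -scalemxAr mulmxA ew mul_scalar_mx scalerA.
  have [c0|c0] := eqVneq c 0.
    move/eqP: c0; rewrite mul_row_tr_eq0 => /eqP w0.
    by rewrite w0 scaler0 subr0; apply/eqP; rewrite eq_sym -subr_eq0 -/w w0.
  rewrite (_ : _ * _ = -1); last by field.
  by rewrite scaleN1r opprK addrC subrK.
Qed.

Lemma Re_sum (R : rcfType) I (r : seq I) (F : I -> complex R) :
  complex.Re (\sum_(i <- r) F i) = \sum_(i <- r) complex.Re (F i).
Proof. by apply: big_morph => // -[a b] [c d]. Qed.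

Lemma Im_sum (R : rcfType) I (r : seq I) (F : I -> complex R) :
  complex.Im (\sum_(i <- r) F i) = \sum_(i <- r) complex.Im (F i).
Proof. by apply: big_morph => // -[a b] [c d]. Qed.

(** Let [x + i y] be an eigenvector over [R[i]] for the eigenvalue [a + i b].
    Symmetry of [A] gives [x *m A *m y^T = y *m A *m x^T], which reduces to
    [b (|x|^2 + |y|^2) = 0]; hence [b = 0], and then [x] and [y] both satisfy the
    eigenvector equation for [a], and they are not both zero. *)
Lemma sym_eigenvector_ex (R : rcfType) n (A : 'M[R]_n.+1) :
  A^T = A -> exists (a : R) (u : 'rV[R]_n.+1), u *m A = a *: u /\ u != 0.
Proof.
move=> A_sym.
have [[a b] /eigenvalueP[v vA v_neq0]] :=
  eigenvalue_closed (map_mx (real_complex R) A) (ltn0Sn n).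
pose x := map_mx (@complex.Re R) v; pose y := map_mx (@complex.Im R) v.
have xA : x *m A = a *: x - b *: y.
  apply/rowP => j; have /rowP/(_ j)/(congr1 (@complex.Re R)) := vA.
  rewrite !mxE Re_sum; case: (v 0 j) => p q /= <-.
  apply: eq_bigr => k _; rewrite !mxE; case: (v 0 k) => p' q' /=.
  by rewrite mulr0 subr0.
have yA : y *m A = a *: y + b *: x.
  apply/rowP => j; have /rowP/(_ j)/(congr1 (@complex.Im R)) := vA.
  rewrite !mxE Im_sum; case: (v 0 j) => p q /= <-.
  apply: eq_bigr => k _; rewrite !mxE; case: (v 0 k) => p' q' /=.
  by rewrite mulr0 add0r.
have xy_neq0 : (x != 0) || (y != 0).
  apply: contraNT v_neq0; rewrite negb_or !negbK => /andP[/eqP x0 /eqP y0].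
  apply/eqP/rowP => j; have /rowP/(_ j) := x0; have /rowP/(_ j) := y0.
  by rewrite !mxE; case: (v 0 j) => p q /= -> ->.
have xx_yy : b * ((x *m x^T) 0 0 + (y *m y^T) 0 0) = 0.
  have /(congr1 (fun M : 'M_1 => M 0 0)) : x *m A *m y^T = y *m A *m x^T.
    by rewrite [RHS]mul_row_trC trmx_mul A_sym mulmxA.
  rewrite xA yA mulmxBl mulmxDl -!scalemxAl (mul_row_trC y x) !mxE.
  set p := \sum_j _; set q := \sum_j _; set r := \sum_j _; lra.
have b0 : b = 0.
  move/eqP: xx_yy; rewrite mulf_eq0 paddr_eq0 ?mul_row_tr_ge0 //.
  rewrite !mul_row_tr_eq0.
  by case/orP => [/eqP //|/andP[/eqP x0 /eqP y0]]; move: xy_neq0; rewrite x0 y0 eqxx.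
move: xA yA; rewrite b0 !scale0r subr0 addr0 => xA yA.
by case/orP: xy_neq0 => ?; exists a; [exists x | exists y].
Qed.

(** Deflation: a reflection that sends a multiple of the first basis vector to
    an eigenvector of [A] conjugates [A] to a symmetric matrix whose first row,
    and therefore first column, vanishes off the diagonal. *)
Lemma sym_spectral (R : rcfType) n (A : 'M[R]_n) : A^T = A ->
  exists Q D : 'M[R]_n,
    [/\ Q^T *m Q = 1%:M, is_diag_mx D & A = Q^T *m D *m Q].
Proof.
elim: n A => [|n IHn] A A_sym.
  exists 1%:M, 0; split; last by apply/matrixP => -[].
    by rewrite trmx1 mulmx1.
  exact: mx0_is_diag.
have [a [u [uA u_neq0]]] := sym_eigenvector_ex A_sym.
pose c := (u *m u^T) 0 0.
have c_gt0 : 0 < c by rewrite lt0r mul_row_tr_eq0 u_neq0 mul_row_tr_ge0.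
(* The first basis vector is rescaled to the norm of [u], which spares
   normalizing [u] itself. *)
pose e : 'rV[R]_(1 + n) := row_mx (Num.sqrt c)%:M 0.
have ee : u *m u^T = e *m e^T.
  rewrite tr_row_mx mul_row_col trmx0 mulmx0 addr0 tr_scalar_mx -scalar_mxM.
  by rewrite -expr2 sqr_sqrtr ?ltW // -mx11_scalar.
have [H [H_sym HH eH]] := reflection_ex ee.
pose B : 'M[R]_(1 + n) := H *m A *m H.
have B_sym : B^T = B by rewrite /B !trmx_mul H_sym A_sym mulmxA.
have eB : e *m B = a *: e.
  by rewrite /B !mulmxA eH uA -scalemxAl -eH -mulmxA HH mulmx1.
pose B' : 'M[R]_n := drsubmx B.
have s_neq0 : Num.sqrt c != 0 by rewrite sqrtr_eq0 -ltNge.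
have BE : B = block_mx a%:M 0 0 B'.
  have := eB; rewrite -[B in e *m B]submxK mul_row_block !mul0mx !addr0 scale_row_mx.
  rewrite !mul_scalar_mx => /eq_row_mx[/(congr1 (fun M => (Num.sqrt c)^-1 *: M)) ul].
  move=> /(congr1 (fun M => (Num.sqrt c)^-1 *: M)).
  rewrite !scaler0 scalerA mulVf // scale1r => ur.
  move: ul; rewrite scalerA mulVf // scale1r => ul.
  rewrite -[LHS]submxK ur; congr (block_mx _ _ _ _).
    by rewrite ul !scale_scalar_mx; congr _%:M; field.
  by rewrite -[B]B_sym -trmx_ursub ur trmx0.
have B'_sym : B'^T = B' by rewrite /B' trmx_drsub B_sym.
have [Q [D [QQ D_diag B'E]]] := IHn B' B'_sym.
pose Q1 : 'M[R]_(1 + n) := block_mx 1%:M 0 0 Q.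
pose D1 : 'M[R]_(1 + n) := block_mx a%:M 0 0 D.
have Q1tr : Q1^T = block_mx 1%:M 0 0 Q^T.
  by rewrite tr_block_mx !trmx0 trmx1.
have QQ1 : Q1^T *m Q1 = 1%:M.
  rewrite Q1tr mulmx_block !(mulmx0, mul0mx, addr0, add0r, mul1mx) QQ.
  by rewrite -scalar_mx_block.
have QDQ1 : B = Q1^T *m D1 *m Q1.
  rewrite BE Q1tr !mulmx_block.
  by rewrite !(mulmx0, mul0mx, addr0, add0r, mul1mx, mulmx1) -B'E.
have D1_diag : is_diag_mx D1.
  by rewrite is_diag_block_mx // !eqxx scalar_mx_is_diag.
exists (Q1 *m H), D1; split.
- by rewrite trmx_mul H_sym mulmxA -(mulmxA H) QQ1 mulmx1.
- exact: D1_diag.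
- have -> : A = H *m B *m H.
    by rewrite /B !mulmxA HH mul1mx -mulmxA HH mulmx1.
  by rewrite trmx_mul H_sym QDQ1 !mulmxA.
Qed.

Lemma mxdiag_is_diag (V : nmodType) p (p_ : 'I_p -> nat)
    (B : forall i, 'M[V]_(p_ i)) :
  (forall i, is_diag_mx (B i)) -> is_diag_mx (\mxdiag_i B i).
Proof.
move=> B_diag; apply/is_diag_mxblockP; split=> [i j /negPf -> //|i].
by rewrite eqxx conform_mx_id.
Qed.

Theorem theorem5p6 (R : realType) (m L : nat) (A : 'I_L -> 'M[R]_m)
    (L_gt0 : (0 < L)%N) (A_sym : forall i : 'I_L, (A i)^T = A i) :
  SDO (L * m) A.
Proof.
have /fin_all_exists[Q spectralQ] : forall i, exists Q : 'M[R]_m * 'M[R]_m,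
    [/\ Q.1^T *m Q.1 = 1%:M, is_diag_mx Q.2 & A i = Q.1^T *m Q.2 *m Q.1].
  by move=> i; have [U [D UD]] := sym_spectral (A_sym i); exists (U, D).
have -> : (L * m = \sum_(i < L) m)%N by rewrite sum_nat_const card_ord.
have L_neq0 : L%:R != 0 :> R by rewrite pnatr_eq0 -lt0n.
pose s : R := (Num.sqrt L%:R)^-1.
have ss : s * s = L%:R^-1 by rewrite -invfM -expr2 sqr_sqrtr ?ler0n.
have trZ (M : 'M[R]_m) : (s *: M)^T = s *: M^T by rewrite linearZ.
(* The factor [L] in the diagonal blocks cancels the two factors [s] that come
   from [P^T] and [P]. *)
exists (\mxcol_i (s *: (Q i).1)).
exists (fun i => \mxdiag_j (if j == i then L%:R *: (Q j).2 else 0)).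
split=> [|i|i].
- rewrite /stiefel tr_mxcol mul_mxrow_mxcol.
  rewrite (eq_bigr (fun=> (L%:R^-1)%:M)) => [|i _].
    by rewrite sumr_const card_ord -scaler_nat scale_scalar_mx divff.
  have [QQ _ _] := spectralQ i.
  by rewrite trZ -scalemxAl -scalemxAr scalerA ss QQ scalemx1.
- apply: mxdiag_is_diag => j; case: eqP => _; last exact: mx0_is_diag.
  have [_ /diag_mxP[d ->] _] := spectralQ j.
  by rewrite -[_ *: _]linearZ diag_mx_is_diag.
- rewrite -mulmxA mul_mxdiag_mxcol tr_mxcol mul_mxrow_mxcol (bigD1 i) //=.
  rewrite eqxx big1 => [|j /negPf ->]; last by rewrite mul0mx mulmx0.
  have [_ _ ->] := spectralQ i.
  rewrite addr0 trZ -!(scalemxAl, scalemxAr) !scalerA.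
  by rewrite mulrCA ss divff // scale1r mulmxA.
Qed.
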